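(* Let $p$ be an odd prime, $n=2k$ and $F:\mathbb{F}_{p^n}\to\mathbb{F}_{p^n}$, $$F(x)=L(x)+(x^{p^k}-x+\delta)^s,\quad \delta\in\mathbb{F}_{p^n},$$ where $L\in\mathbb{F}_{p^k}[x]$ is a linear permutation (of $\mathbb{F}_{p^n}$) and $s$ is any integer in the range $[1,p^n-2]$. Define $$G(y)=-L(y)+(y+\delta)^s-(y+\delta)^{p^ks},\quad y\in\mathbb{F}_{p^n},$$ and $\mathcal{S}=\{y\in\mathbb{F}_{p^n}\mid T^n_k(y)=0\}$. Then: (i) $F$ is a permutation of $\mathbb{F}_{p^n}$ if and only if $G$ permutes $\mathcal{S}$. In particular, if $p^ks\equiv s\pmod{p^n-1}$ then $F$ is a permutation. (ii) The component functions $F_\lambda$ of $F$ are balanced (i.e. $A_\lambda=0$) for all $\lambda\in\mathbb{F}_{p^n}^*$ satisfying $T^n_k(\lambda)\neq0$. If $T^n_k(\lambda)=0$, then $$A_\lambda=p^k\sum_{y\in\mathcal{S}}\zeta_p^{T^k_1(\lambda G(y))}.$$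
   Context: A linear permutation $L\in\mathbb{F}_{p^k}[x]$ means a linearized polynomial $L(x)=\sum_i a_ix^{p^i}$ with coefficients $a_i\in\mathbb{F}_{p^k}$ inducing a bijection of $\mathbb{F}_{p^n}$. For $n=2k$, $T^n_k(x)=x+x^{p^k}$ is the trace $\mathbb{F}_{p^n}\to\mathbb{F}_{p^k}$; $T^k_1$ is the absolute trace $\mathbb{F}_{p^k}\to\mathbb{F}_p$; $Tr$ is the absolute trace $\mathbb{F}_{p^n}\to\mathbb{F}_p$. For $\lambda\in\mathbb{F}_{p^n}$, $F_\lambda(x)=Tr(\lambda F(x))$ and $A_\lambda=\sum_{x\in\mathbb{F}_{p^n}}\zeta_p^{Tr(\lambda F(x))}$, where $\zeta_p=e^{2\pi\sqrt{-1}/p}$. (When $T^n_k(\lambda)=0$ and $y\in\mathcal{S}$, $\lambda G(y)\in\mathbb{F}_{p^k}$.) *)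

(* Defs.v *)
From HB Require Import structures.
From mathcomp Require Import all_boot all_order all_algebra.
From mathcomp Require Import complex.
From mathcomp Require Import reals trigo.

Set Implicit Arguments.
Unset Strict Implicit.
Unset Printing Implicit Defensive.

Import Order.TTheory GRing.Theory Num.Theory.
Local Open Scope ring_scope.

(* Throughout, E plays the role of F_{p^n}, n = 2k, and K that of its subfield
   F_{p^k}.  All elements of F_{p^k} and F_p are seen inside E; in particular
   the traces below are E-valued. *)

Definition linearized (E : finFieldType) (K : {pred E}) (p : nat)
    (L : {poly E}) : Prop :=
  exists m (a : 'I_m -> E),
    (forall i, a i \in K) /\ L = \sum_(i < m) a i *: 'X^(p ^ i).

(* T^n_k for n = 2k *)
Definition trace_half (E : finFieldType) (p k : nat) (x : E) : E :=
  x + x ^+ (p ^ k).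

(* The absolute trace F_{p^m} -> F_p, written T^m_1; Tr is the case m = n. *)
Definition abs_trace (E : finFieldType) (p m : nat) (x : E) : E :=
  \sum_(i < m) x ^+ (p ^ i).

(* The representative in {0, ..., p-1} of an element of the prime subfield of E
   (the value 0 outside the prime subfield is a dummy). *)
Definition prime_repr (E : finFieldType) (p : nat) (z : E) : nat :=
  if [pick t : 'I_p | (t : nat)%:R == z] is Some t then t else 0%N.

Definition zeta (R : realType) (p : nat) : R[i] :=
  Complex (cos (2 * pi / p%:R)) (sin (2 * pi / p%:R)).

(* zeta_p ^ z for z in the prime subfield of E *)
Definition zeta_pow (R : realType) (E : finFieldType) (p : nat) (z : E) : R[i] :=
  zeta R p ^+ prime_repr p z.

Definition permutes (E : finFieldType) (S : {set E}) (g : E -> E) : Prop :=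
  {in S &, injective g} /\ g @: S = S.

Definition mapF (E : finFieldType) (p k s : nat) (L : {poly E}) (delta : E)
    (x : E) : E :=
  L.[x] + (x ^+ (p ^ k) - x + delta) ^+ s.

Definition mapG (E : finFieldType) (p k s : nat) (L : {poly E}) (delta : E)
    (y : E) : E :=
  - L.[y] + (y + delta) ^+ s - (y + delta) ^+ (p ^ k * s).

Definition trace_kernel (E : finFieldType) (p k : nat) : {set E} :=
  [set y | trace_half p k y == 0].

Definition component (E : finFieldType) (p n : nat) (F : E -> E) (lam : E)
    (x : E) : E :=
  abs_trace p n (lam * F x).

Definition char_sum (R : realType) (E : finFieldType) (p n : nat) (F : E -> E)
    (lam : E) : R[i] :=
  \sum_(x : E) zeta_pow R p (component p n F lam x).

(* Main.v *)
(** Write q = p^k and psi(x) = x^q - x.  This map is F_q-linear with kernel K,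
    and maps E onto S = ker (1 + x^q), since psi (-y/2) = y for y in S.  As L
    has coefficients in K it commutes with the q-Frobenius, whence
    psi (F x) = - G (psi x); and F (x + c) = F x + L c for c in K, so F is
    injective on each fibre of psi.  Hence F is bijective exactly when the
    quotient map -G is.

    For the sums, translating x by c in K multiplies A_lambda by
    zeta^Tr(lambda L(c)), where Tr(lambda L(c)) = T^k_1 (T^n_k(lambda) L(c));
    if T^n_k(lambda) <> 0, some c makes this factor different from 1.  If
    T^n_k(lambda) = 0, then lambda^q = - lambda gives
    T^n_k (lambda F(x)) = lambda G(psi x), and every fibre of psi has q
    elements. *)

Require Import Defs.
From HB Require Import structures.
From mathcomp Require Import all_boot all_order all_algebra.
From mathcomp Require Import finfield.
From mathcomp Require Import ring lra.
From mathcomp Require Import complex.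
From mathcomp Require Import reals trigo.

Set Implicit Arguments.
Unset Strict Implicit.
Unset Printing Implicit Defensive.

Import Order.TTheory GRing.Theory Num.Theory.
Local Open Scope ring_scope.

(** * The complex root of unity [zeta R p] *)

Section RootsOfUnity.

Context (R : realType) (p : nat) (p_gt0 : (0 < p)%N).

Lemma zetaX m : zeta R p ^+ m =
  Complex (cos (2 * pi / p%:R *+ m)) (sin (2 * pi / p%:R *+ m)).
Proof.
rewrite /zeta; move: (2 * pi / p%:R : R) => a.
elim: m => [|m IHm]; first by rewrite expr0 mulr0n cos0 sin0.
by rewrite exprS IHm mulrS cosD sinD; simpc; rewrite [sin a * _ + _]addrC.
Qed.

Lemma zeta_order : zeta R p ^+ p = 1.
Proof.
have p_neq0 : p%:R != 0 :> R by rewrite pnatr_eq0 -lt0n.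
by rewrite zetaX -[_ *+ p]mulr_natr divfK // mulr_natl cos2pi sin2pi.
Qed.

(** The real part is already different from 1: with [a = pi * t / p] strictly between 0 and [pi], it
    equals [1 - 2 * sin a ^+ 2 < 1]. *)
Lemma zetaX_neq1 t : (0 < t < p)%N -> zeta R p ^+ t != 1.
Proof.
move=> /andP[t_gt0 t_lt_p]; rewrite zetaX eq_complex negb_and /=.
apply/orP; left; set a := pi * (t%:R / p%:R) : R.
have pR_gt0 : 0 < p%:R :> R by rewrite ltr0n.
have -> : 2 * pi / p%:R *+ t = a *+ 2 :> R.
  by rewrite /a -mulr_natl -[RHS]mulr_natl; ring.
have sin_a : 0 < sin a.
  apply: sin_gt0_pi; rewrite mulr_gt0 ?pi_gt0 ?divr_gt0 ?ltr0n //=.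
  by rewrite /a gtr_pMr ?pi_gt0 // ltr_pdivrMr // mul1r ltr_nat.
rewrite cos_mulr2n cos2sin2 lt_eqF //.
have : 0 < sin a ^+ 2 by rewrite exprn_gt0.
lra.
Qed.

End RootsOfUnity.

(** Used with [c = 1] and [m = p] or [m = p ^ k], to recognise the prime subfield and [K] as the
    full sets of fixed points of the corresponding Frobenius powers. *)
Lemma card_expr_eq_scale (F : finFieldType) (m : nat) (c : F) :
  (1 < m)%N -> (#|[set x : F | x ^+ m == (c * x)%R]| <= m)%N.
Proof.
move=> m_gt1; pose P := 'X^m - c *: 'X : {poly F}.
have sizeP : size P = m.+1.
  rewrite size_polyDl ?size_polyXn // size_polyN.
  by rewrite (leq_ltn_trans (size_scale_leq _ _)) // size_polyX.
rewrite -ltnS -sizeP cardE; apply: max_poly_roots; last exact: enum_uniq.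
  by rewrite -size_poly_eq0 sizeP.
apply/allP => x; rewrite mem_enum inE => /eqP xm.
by rewrite /root !hornerE xm subrr.
Qed.

(** * Frobenius, prime subfield and absolute trace *)

Section PrimeCharacteristic.

Context (E : finFieldType) (p : nat) (charEp : p \in [pchar E]).

Let p_gt0 : (0 < p)%N.
Proof. exact/prime_gt0/(pcharf_prime charEp). Qed.

Let p_gt1 : (1 < p)%N.
Proof. exact/prime_gt1/(pcharf_prime charEp). Qed.

Lemma pchar_expn_nat i : [pchar E].-nat (p ^ i)%N.
Proof. by rewrite pnatX (pnatE _ (pcharf_prime charEp)) charEp. Qed.

Lemma frobD i (x y : E) : (x + y) ^+ (p ^ i) = x ^+ (p ^ i) + y ^+ (p ^ i).
Proof. exact: exprDn_pchar (pchar_expn_nat i). Qed.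

Lemma frobN i (x : E) : (- x) ^+ (p ^ i) = - x ^+ (p ^ i).
Proof. exact: exprNn_pchar (pchar_expn_nat i). Qed.

Lemma frobB i (x y : E) : (x - y) ^+ (p ^ i) = x ^+ (p ^ i) - y ^+ (p ^ i).
Proof. by rewrite frobD frobN. Qed.

Lemma frob_sum i (I : Type) (r : seq I) (f : I -> E) :
  (\sum_(j <- r) f j) ^+ (p ^ i) = \sum_(j <- r) f j ^+ (p ^ i).
Proof.
apply: (big_morph (fun x : E => x ^+ (p ^ i))); first exact: frobD.
by rewrite expr0n expn_eq0 eqn0Ngt p_gt0.
Qed.

Lemma natr_eq_mod m l : (m%:R == l%:R :> E) = (m == l %[mod p]).
Proof.
wlog le_lm : m l / (l <= m)%N => [hwlog|].
  case/orP: (leq_total l m) => [|le]; first exact: hwlog.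
  by rewrite eq_sym hwlog // eq_sym.
by rewrite eqn_mod_dvd // (dvdn_pcharf charEp) natrB // subr_eq0.
Qed.

Lemma prime_repr_natr m : prime_repr p (m%:R : E) = (m %% p)%N.
Proof.
rewrite /prime_repr; case: pickP => [t | /(_ (Ordinal (ltn_pmod m p_gt0)))].
  by rewrite natr_eq_mod => /eqP <-; rewrite modn_small.
by rewrite /= natr_eq_mod modn_mod eqxx.
Qed.

(** The [p] multiples of 1 are distinct roots of ['X^p - 'X], which has at most [p] roots. *)
Lemma prime_subfieldP (x : E) : x ^+ p = x -> exists t : 'I_p, x = t%:R.
Proof.
move=> xp; pose A := [set (t%:R : E) | t : 'I_p].
have cardA : #|A| = p.
  rewrite card_imset ?card_ord // => t u /eqP.
  by rewrite natr_eq_mod !modn_small // => /eqP/val_inj.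
have /eqP AE : A == [set y : E | y ^+ p == 1 * y].
  rewrite eqEcard cardA card_expr_eq_scale // andbT.
  apply/subsetP => _ /imsetP[t _ ->]; rewrite inE mul1r.
  by rewrite -(pFrobenius_autE charEp) pFrobenius_aut_nat.
have : x \in A by rewrite AE inE xp mul1r.
by case/imsetP => t _ ->; exists t.
Qed.

Section ZetaPow.

Context (R : realType).

Lemma zeta_pow_natr m : zeta_pow R p (m%:R : E) = zeta R p ^+ m.
Proof. by rewrite /zeta_pow prime_repr_natr expr_mod // zeta_order. Qed.

(** Membership in the prime subfield is stated as [x ^+ p = x], the form in which [abs_trace_frob]
    provides it. *)
Lemma zeta_powD (x y : E) : x ^+ p = x -> y ^+ p = y ->
  zeta_pow R p (x + y) = zeta_pow R p x * zeta_pow R p y.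
Proof.
move=> /prime_subfieldP[t ->] /prime_subfieldP[u ->].
by rewrite -natrD !zeta_pow_natr exprD.
Qed.

Lemma zeta_pow_neq1 (x : E) : x ^+ p = x -> x != 0 -> zeta_pow R p x != 1.
Proof.
move=> /prime_subfieldP[t ->] t_neq0; rewrite zeta_pow_natr.
apply: zetaX_neq1 => //; rewrite ltn_ord andbT lt0n.
by apply: contra_neq t_neq0 => ->.
Qed.

End ZetaPow.

Lemma abs_traceD m (x y : E) :
  abs_trace p m (x + y) = abs_trace p m x + abs_trace p m y.
Proof. by rewrite -big_split; apply: eq_bigr => i _; apply: frobD. Qed.

(** Raising to the power [p] shifts the conjugates cyclically: the last one becomes
    [x ^+ (p ^ m) = x]. *)
Lemma abs_trace_frob m (x : E) :
  x ^+ (p ^ m) = x -> abs_trace p m x ^+ p = abs_trace p m x.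
Proof.
case: m => [_|m xpm]; first by rewrite /abs_trace big_ord0 expr0n gtn_eqF.
rewrite /abs_trace -[X in _ ^+ X = _](expn1 p) frob_sum.
under eq_bigr do rewrite -exprM -expnD addn1.
rewrite big_ord_recr [RHS]big_ord_recl /= xpm addrC expn0 expr1.
by congr (_ + _); apply: eq_bigr.
Qed.

(** Transitivity of the trace: the last [k] of the [2 * k] conjugates are those of
    [x ^+ (p ^ k)]. *)
Lemma abs_trace_half k (x : E) :
  abs_trace p (2 * k) x = abs_trace p k (trace_half p k x).
Proof.
rewrite abs_traceD /abs_trace mul2n -addnn big_split_ord /=; congr (_ + _).
by apply: eq_bigr => i _; rewrite expnD exprM.
Qed.

(** The trace is a nonzero polynomial of degree at most [p ^ (k - 1)]. Hence it cannot vanish on a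
    set of [p ^ k] elements such as [K]. *)
Lemma card_abs_trace_eq0 k : (0 < k)%N ->
  (#|[set x : E | abs_trace p k x == 0%R]| < p ^ k)%N.
Proof.
case: k => // k _; pose P := \sum_(i < k.+1) 'X^(p ^ i) : {poly E}.
have P_neq0 : P != 0.
  (* The coefficient of ['X] is 1: only the summand [i = 0] has degree 1. *)
  apply/eqP => /(congr1 (coefp 1))/=; rewrite coef_sum big_ord_recl coefXn.
  rewrite big1 => [|i _]; last first.
    by rewrite coefXn ltn_eqF // -{1}(expn0 p) ltn_exp2l.
  by rewrite addr0 coef0 => /eqP; rewrite oner_eq0.
have sizeP : (size P <= (p ^ k).+1)%N.
  apply: (big_ind (fun Q : {poly E} => size Q <= (p ^ k).+1)%N).
  - by rewrite size_poly0.
  - by move=> Q1 Q2 ? ?; rewrite (leq_trans (size_polyD _ _)) // geq_max; apply/andP.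
  - by move=> i _; rewrite size_polyXn ltnS leq_pexp2l // -ltnS.
apply: (@leq_trans (p ^ k).+1); last by rewrite ltn_exp2l.
rewrite ltnS -ltnS (leq_trans _ sizeP) // cardE.
apply: max_poly_roots => //; last exact: enum_uniq.
apply/allP => x; rewrite mem_enum inE /root horner_sum => /eqP tr0.
by apply/eqP; rewrite -[RHS]tr0; apply: eq_bigr => i _; rewrite hornerXn.
Qed.

End PrimeCharacteristic.

(** * The subfield [K] of order [p ^ k] and the fibres of [psi] *)

Section QuadraticExtension.

Context (p k : nat) (p_prime : prime p) (p_odd : odd p) (k_gt0 : (0 < k)%N).
Context (E : finFieldType) (card_E : #|E| = (p ^ (2 * k))%N).
Context (K : divringClosed E) (card_K : #|K| = (p ^ k)%N).

Local Notation S := (trace_kernel E p k).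
Local Notation psi x := (x ^+ (p ^ k) - x).

Let charEp : p \in [pchar E].
Proof. exact: card_finPcharP card_E p_prime. Qed.

Let q_gt1 : (1 < p ^ k)%N.
Proof. by rewrite -(expn0 p) ltn_exp2l // prime_gt1. Qed.

Lemma exp_card_sqr (x : E) : x ^+ (p ^ k) ^+ (p ^ k) = x.
Proof. by rewrite -exprM -expnD addnn -mul2n -card_E expf_card. Qed.

(** Fermat's argument: multiplication by [x != 0] permutes the nonzero elements of [K], so their
    product [P] satisfies [x ^+ (#|K| - 1) * P = P]. *)
Lemma subfield_expf_card (x : E) : x \in K -> x ^+ (p ^ k) = x.
Proof.
have [-> _|x_neq0 xK] := eqVneq x 0.
  by rewrite expr0n gtn_eqF // ltnW.
pose P := \prod_(y in K | y != 0) y.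
have P_neq0 : P != 0 by apply/prodf_neq0 => y /andP[].
have cardK0 : #|K| = #|[pred y in K | y != 0]|.+1.
  rewrite (cardD1 0 K) rpred0 add1n; congr _.+1.
  by apply: eq_card => y; rewrite !inE andbC.
rewrite -card_K cardK0 exprS -[RHS]mulr1; congr (_ * _).
apply: (mulIf P_neq0); rewrite mul1r.
rewrite [RHS](reindex_inj (mulfI x_neq0)) /= -prodr_const -big_split /=.
by apply: eq_bigl => y; rewrite inE /= fpredMl // mulf_eq0 negb_or x_neq0.
Qed.

(** [K] consists of [p ^ k] solutions of an equation with at most [p ^ k] solutions. *)
Lemma mem_subfieldE (x : E) : (x \in K) = (x ^+ (p ^ k) == x).
Proof.
pose fixq := [set y : E | y ^+ (p ^ k) == 1 * y].
have K_sub : K \subset fixq.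
  by apply/subsetP => y yK; rewrite inE mul1r subfield_expf_card.
have cardK : #|K| = #|fixq|.
  by apply/eqP; rewrite eqn_leq subset_leq_card // card_K card_expr_eq_scale.
by rewrite (subset_cardP cardK K_sub) inE mul1r.
Qed.

Lemma mem_trace_kernel (y : E) : (y \in S) = (y ^+ (p ^ k) == - y).
Proof. by rewrite inE /trace_half addrC addr_eq0. Qed.

Lemma psi_trace_kernel (x : E) : psi x \in S.
Proof. by rewrite mem_trace_kernel (frobB charEp) exp_card_sqr opprB. Qed.

Lemma psi_eqE (x x' : E) : (psi x == psi x') = (x - x' \in K).
Proof.
rewrite mem_subfieldE (frobB charEp) -subr_eq0 -[RHS]subr_eq0.
by congr (_ == 0); ring.
Qed.

Lemma psi_surj (y : E) : y \in S -> exists x : E, psi x = y.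
Proof.
rewrite mem_trace_kernel => /eqP yq; exists (- (y / 2)).
(* Halving [y] requires odd characteristic. *)
have two_neq0 : 2 != 0 :> E.
  rewrite -(dvdn_pcharf charEp) (dvdn_prime2 p_prime) //.
  by apply: contraL p_odd => /eqP ->.
have twoq : (2 : E) ^+ (p ^ k) = 2.
  by rewrite -[2]/(1 + 1) (frobD charEp) expr1n.
rewrite (frobN charEp) expr_div_n yq twoq.
by field.
Qed.

Lemma card_psi_fiber (y : E) : y \in S -> #|[pred x : E | psi x == y]| = (p ^ k)%N.
Proof.
move=> /psi_surj[x0 <-]; rewrite -[RHS]card_K -[RHS](card_imset K (addrI x0)).
apply: eq_card => x; rewrite inE psi_eqE; apply/idP/imsetP => [xK|[c cK ->]].
  by exists (x - x0) => //; rewrite addrC subrK.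
by rewrite addrC addKr.
Qed.

Lemma sum_psi (A : pzRingType) (f : E -> A) :
  \sum_(x : E) f (psi x) = (p ^ k)%:R * \sum_(y in S) f y.
Proof.
rewrite (partition_big (fun x : E => psi x) (mem S)) => [|x _]; last first.
  exact: psi_trace_kernel.
rewrite mulr_sumr; apply: eq_bigr => y yS.
rewrite (eq_bigr (fun=> f y)) => [|x /eqP -> //].
by rewrite sumr_const card_psi_fiber // mulr_natl.
Qed.

(** * The maps [F] and [G], and the permutation criterion *)

Section Mapping.

Context (s : nat) (delta : E).
Context (L : {poly E}) (L_lin : linearized K p L).
Context (L_inj : injective (fun x : E => L.[x])).

Local Notation F := (mapF p k s L delta).
Local Notation G := (mapG p k s L delta).

Lemma linearizedD (x y : E) : L.[x + y] = L.[x] + L.[y].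
Proof.
have [m [a [_ ->]]] := L_lin.
rewrite !horner_sum -big_split; apply: eq_bigr => i _.
by rewrite !hornerE (frobD charEp) mulrDr.
Qed.

Lemma linearized0 : L.[0] = 0.
Proof. by apply: (addrI L.[0]); rewrite -linearizedD !addr0. Qed.

Lemma linearizedN (x : E) : L.[- x] = - L.[x].
Proof. by apply/eqP; rewrite -addr_eq0 -linearizedD addNr linearized0. Qed.

Lemma linearized_frob (x : E) : L.[x] ^+ (p ^ k) = L.[x ^+ (p ^ k)].
Proof.
have [m [a [aK ->]]] := L_lin.
rewrite !horner_sum (frob_sum charEp); apply: eq_bigr => i _.
by rewrite !hornerE exprMn (subfield_expf_card (aK i)) exprAC.
Qed.

(** [F] descends along [psi] because its power term depends on [x] only through [psi x], and [L]
    commutes with [psi]. *)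
Lemma psi_mapF (x : E) : psi (F x) = - G (psi x).
Proof.
rewrite /mapF /mapG (frobD charEp) linearized_frob -exprM [(s * _)%N]mulnC.
by rewrite linearizedD linearizedN; ring.
Qed.

Lemma mapF_shift (x c : E) : c \in K -> F (x + c) = F x + L.[c].
Proof.
rewrite mem_subfieldE => /eqP cq; rewrite /mapF (frobD charEp) cq linearizedD.
by rewrite [x + c]addrC addrKA addrAC.
Qed.

Lemma trace_kernelN (y : E) : (- y \in S) = (y \in S).
Proof. by rewrite !mem_trace_kernel (frobN charEp) eqr_opp. Qed.

Lemma mapG_trace_kernel (y : E) : y \in S -> G y \in S.
Proof.
by move=> /psi_surj[x <-]; rewrite -trace_kernelN -psi_mapF psi_trace_kernel.
Qed.

Lemma inj_mapF : {in S &, injective G} -> injective F.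
Proof.
move=> G_inj x x' eqF.
have /eqP : psi x = psi x'.
  apply: G_inj; rewrite ?psi_trace_kernel //.
  by apply: oppr_inj; rewrite -!psi_mapF eqF.
(* The difference [c = x - x'] lies in [K], so [F x = F x' + L.[c]]; equality of the two values
   gives [L.[c] = 0], hence [c = 0]. *)
rewrite psi_eqE => /(mapF_shift x'); rewrite addrC subrK eqF.
rewrite -[LHS]addr0 => /addrI; rewrite -linearized0 => /L_inj/esym/eqP.
by rewrite subr_eq0 => /eqP.
Qed.

Lemma permutes_mapG : injective F -> permutes S G.
Proof.
move=> F_inj; have [F' _ F'K] := injF_bij F_inj.
have GS : G @: S = S.
  apply/eqP; rewrite eqEsubset; apply/andP; split; apply/subsetP => y.
    by case/imsetP => z /mapG_trace_kernel zS ->.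
  (* With [psi x = - y], applying [psi_mapF] at [F' x] gives [- y = - G (psi (F' x))]. Injectivity
     of [G] then follows from surjectivity, as [S] is finite. *)
  rewrite -trace_kernelN => /psi_surj[x psi_x]; apply/imsetP.
  exists (psi (F' x)); first exact: psi_trace_kernel.
  by apply: oppr_inj; rewrite -psi_mapF F'K.
by split => //; apply/imset_injP; rewrite GS.
Qed.

Lemma mapF_bijP : bijective F <-> permutes S G.
Proof.
split; first by move/bij_inj/permutes_mapG.
by case=> G_inj _; apply/injF_bij/inj_mapF.
Qed.

Lemma mapF_bij_mod :
  (p ^ k * s = s %[mod p ^ (2 * k) - 1])%N -> bijective F.
Proof.
move=> s_mod; apply/injF_bij/inj_mapF => y z _ _.
have exp_s (x : E) : x ^+ (p ^ k * s) = x ^+ s.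
  have [->|x_neq0] := eqVneq x 0.
    by rewrite !expr0n muln_eq0 expn_eq0 !eqn0Ngt prime_gt0.
  have x1 : x ^+ (p ^ (2 * k) - 1) = 1.
    apply: (mulfI x_neq0); rewrite mulr1 -exprS subn1 prednK ?expn_gt0 ?prime_gt0 //.
    by rewrite -card_E expf_card.
  by rewrite -(expr_mod _ x1) s_mod expr_mod.
by rewrite /mapG !exp_s !addrK => /oppr_inj/L_inj.
Qed.

Section CharSum.

Context (R : realType).

Lemma component_frob (lam x : E) :
  component p (2 * k) F lam x ^+ p = component p (2 * k) F lam x.
Proof. by apply: (abs_trace_frob charEp); rewrite -card_E expf_card. Qed.

Lemma linearized_onto_subfield (z : E) : z \in K -> exists2 c, c \in K & L.[c] = z.
Proof.
have [L' _ L'K] := injF_bij L_inj.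
rewrite mem_subfieldE => /eqP zq; exists (L' z); last exact: L'K.
by rewrite mem_subfieldE; apply/eqP/L_inj; rewrite -linearized_frob L'K.
Qed.

Lemma trace_halfM (lam c : E) : c \in K ->
  trace_half p k (lam * c) = trace_half p k lam * c.
Proof.
by rewrite mem_subfieldE /trace_half exprMn => /eqP ->; rewrite mulrDl.
Qed.

Lemma trace_half_subfield (x : E) : trace_half p k x \in K.
Proof. by rewrite mem_subfieldE /trace_half (frobD charEp) exp_card_sqr addrC. Qed.

Lemma char_sum_balanced (lam : E) :
  trace_half p k lam != 0 -> char_sum R p (2 * k) F lam = 0.
Proof.
set mu := trace_half p k lam => mu_neq0.
have [z zK trz] : exists2 z, z \in K & abs_trace p k z != 0.
  apply/exists_inP; apply: contraTT (card_abs_trace_eq0 charEp k_gt0).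
  rewrite negb_exists_in => /forall_inP tr0; rewrite -leqNgt -card_K.
  by apply/subset_leq_card/subsetP => z /tr0; rewrite negbK inE.
have [|c cK Lc] := @linearized_onto_subfield (z / mu).
  by rewrite rpred_div // trace_half_subfield.
have trE : abs_trace p (2 * k) (lam * L.[c]) = abs_trace p k z.
  have LcK : L.[c] \in K by rewrite Lc rpred_div // trace_half_subfield.
  by rewrite (abs_trace_half charEp) trace_halfM // Lc mulrC divfK.
have tr_frob : abs_trace p k z ^+ p = abs_trace p k z.
  by apply: (abs_trace_frob charEp); apply: subfield_expf_card.
have shiftE : char_sum R p (2 * k) F lam =
    char_sum R p (2 * k) F lam * zeta_pow R p (abs_trace p k z).
  rewrite {1}/char_sum (reindex_inj (addIr c)) /= mulr_suml.
  apply: eq_bigr => x _; rewrite -(zeta_powD charEp) ?component_frob //.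
  by rewrite /component mapF_shift // mulrDr (abs_traceD charEp) trE.
apply/eqP; move/eqP: shiftE.
rewrite -[X in X == _]mulr1 -subr_eq0 -mulrBr mulf_eq0 => /orP[//|].
by rewrite subr_eq0 eq_sym (negPf (zeta_pow_neq1 charEp R tr_frob trz)).
Qed.

Lemma char_sum_trace_kernel (lam : E) : trace_half p k lam = 0 ->
  char_sum R p (2 * k) F lam =
    (p ^ k)%:R * \sum_(y in S) zeta_pow R p (abs_trace p k (lam * G y)).
Proof.
move=> /eqP; rewrite /trace_half addrC addr_eq0 => /eqP lamq.
rewrite -sum_psi; apply: eq_bigr => x _.
rewrite /component (abs_trace_half charEp); congr (zeta_pow R p (abs_trace p k _)).
rewrite -[G _]opprK -psi_mapF /trace_half exprMn lamq.
by rewrite opprB mulNr mulrBr.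
Qed.

End CharSum.

End Mapping.

End QuadraticExtension.

Theorem proposition9 (R : realType) (p n k s : nat)
    (p_prime : prime p) (p_odd : odd p) (k_gt0 : (0 < k)%N) (n_eq : n = (2 * k)%N)
    (E : finFieldType) (card_E : #|E| = (p ^ n)%N)
    (K : divringClosed E) (card_K : #|K| = (p ^ k)%N)
    (L : {poly E}) (L_lin : linearized K p L) (L_perm : bijective (fun x : E => L.[x]))
    (s_range : (1 <= s <= p ^ n - 2)%N) (delta : E) :
  let F := mapF p k s L delta in
  let G := mapG p k s L delta in
  let S := trace_kernel E p k in
  ((bijective F <-> permutes S G) /\
   ((p ^ k * s = s %[mod p ^ n - 1])%N -> bijective F)) /\
  ((forall lam : E, lam != 0 -> trace_half p k lam != 0 ->
      char_sum R p n F lam = 0) /\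
   (forall lam : E, trace_half p k lam = 0 ->
      char_sum R p n F lam =
        (p ^ k)%:R * \sum_(y in S) zeta_pow R p (abs_trace p k (lam * G y)))).
Proof.
subst n => F G S; have L_inj := bij_inj L_perm.
split; split.
- exact: (mapF_bijP p_prime p_odd k_gt0 card_E card_K).
- exact: (mapF_bij_mod p_prime k_gt0 card_E card_K).
- by move=> lam _; apply: (char_sum_balanced p_prime k_gt0 card_E card_K).
- exact: (char_sum_trace_kernel p_prime p_odd k_gt0 card_E card_K).
Qed.
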